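(* Let $G$ be a group with an involution $\alpha$, let $(\mathcal{K},\mathcal{J})$ be a Krein space, let $\pi$ be a $\mathcal{J}$-unitary representation of $G$ on $(\mathcal{K},\mathcal{J})$, let $\mathcal{H}$ be a Hilbert space and let $V:\mathcal{H}\to\mathcal{K}$ be a bounded linear operator such that $[\pi(G)V\mathcal{H}]=\mathcal{K}$ and $\mathcal{J}\pi(g)V=\pi(\alpha(g))V$ for all $g\in G$. Then the map $\varphi:G\to L(\mathcal{H})$ defined by $\varphi(g)=V^{*}\pi(g)V$ is an $\alpha$-completely positive map.
   Context: An involution of a group $G$ (with identity $e$) is a map $\alpha:G\to G$ (assumed continuous if $G$ is a topological group) with $\alpha^{2}=\mathrm{id}_G$, $\alpha(e)=e$ and $\alpha(g^{-1})=\alpha(g)^{-1}$ for all $g\in G$; it is not required to be a homomorphism. $L(\mathcal{H})$ denotes the bounded linear operators on a Hilbert space $\mathcal{H}$. An $n\times n$ matrix with entries in $L(\mathcal{H})$ is regarded as an operator on $\mathcal{H}^n$; positivity and the order $\leq$ between such matrices refer to this. A map $\varphi:G\to L(\mathcal{H})$ is $\alpha$-completely positive if: (1) $\varphi(\alpha(g_1)\alpha(g_2))=\varphi(\alpha(g_1g_2))=\varphi(g_1g_2)$ for all $g_1,g_2\in G$; (2) for all $n$ and $g_1,\dots,g_n\in G$, the matrix $[\varphi(\alpha(g_i)^{-1}g_j)]_{i,j=1}^n$ is positive; (3) there is $K>0$ such that $[\varphi(g_i)^{*}\varphi(g_j)]_{i,j=1}^n\leq K[\varphi(\alpha(g_i)^{-1}g_j)]_{i,j=1}^n$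 for all $n$ and $g_1,\dots,g_n\in G$; (4) for every $g\in G$ there is $M(g)>0$ such that $[\varphi(\alpha(gg_i)^{-1}gg_j)]_{i,j=1}^n\leq M(g)[\varphi(\alpha(g_i)^{-1}g_j)]_{i,j=1}^n$ for all $n$ and $g_1,\dots,g_n\in G$. A Krein space is a pair $(\mathcal{K},\mathcal{J})$ of a Hilbert space $\mathcal{K}$ and a bounded linear operator $\mathcal{J}$ on $\mathcal{K}$ with $\mathcal{J}=\mathcal{J}^{*}=\mathcal{J}^{-1}$. A $\mathcal{J}$-unitary representation of $G$ on $(\mathcal{K},\mathcal{J})$ is a multiplicative map $\pi:G\to L(\mathcal{K})$ with $\pi(e)=\mathrm{id}_{\mathcal{K}}$ and $\pi(g^{-1})=\mathcal{J}\pi(g)^{*}\mathcal{J}$ for all $g\in G$. $[\pi(G)V\mathcal{H}]$ denotes the closed linear span of $\{\pi(g)V\xi: g\in G,\ \xi\in\mathcal{H}\}$. *)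

(* Defs.v *)
From HB Require Import structures.
From mathcomp Require Import all_boot all_order all_algebra.
From mathcomp Require Import ring lra.
From mathcomp Require Import sesquilinear complex.
From mathcomp Require Import boolp classical_sets functions reals topology normedtype.

Set Implicit Arguments.
Unset Strict Implicit.
Unset Printing Implicit Defensive.

Import Order.TTheory GRing.Theory Num.Theory.
Import numFieldNormedType.Exports.

Local Open Scope classical_set_scope.
Local Open Scope complex_scope.
Local Open Scope ring_scope.

(* Complex Hilbert spaces: the scalar field is R[i], with R the real numbers.
   The inner product is linear in its first argument. *)
HB.mixin Record CompleteNormedModule_isHilbert (R : realType) H
    & CompleteNormedModule R[i] H := {
  inner : {dot H for @Num.conj R[i]} ;
  normr_inner : forall x : H, `|x| ^+ 2 = inner x x
}.

#[short(type="hilbertType")]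
HB.structure Definition Hilbert (R : realType) :=
  {H of CompleteNormedModule_isHilbert R H & CompleteNormedModule R[i] H}.

Notation "''[' x , y ]" := (inner x y)
  (at level 0, format "''[' x ,  y ]") : ring_scope.

Lemma innerC (R : realType) (H : hilbertType R) (x y : H) :
  '[x, y] = Num.conj '[y, x].
Proof. by rewrite [LHS]hermC mul1r. Qed.

Section BoundedOperators.
Variables (R : realType) (H K : hilbertType R).

Definition bounded_linear : {pred H -> K} := fun f =>
  `[< linear f /\ exists M : R, forall x, `|f x| <= M%:C * `|x| >].

Record bop := Bop {
  bop_fun :> H -> K ;
  bop_bounded_linear : bop_fun \in bounded_linear
}.

HB.instance Definition _ := [isSub for bop_fun].
HB.instance Definition _ := [Choice of bop by <:].
HB.instance Definition _ (T : bop) :=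
  GRing.isLinear.Build R[i] H K *:%R (T : H -> K)
  (proj1 (asboolW (bop_bounded_linear T))).

Lemma bop_bounded (T : bop) : exists M : R, forall x, `|T x| <= M%:C * `|x|.
Proof. by case: T => T /= /asboolP[]. Qed.

Lemma bopP (S T : bop) : S =1 T -> S = T.
Proof. by move=> ST; apply/val_inj/funext. Qed.

Lemma normr_RRe (V : normedZmodType R[i]) (x : V) : `|x| = (complex.Re `|x|)%:C.
Proof. by rewrite RRe_real ?normr_real. Qed.

Lemma realCD (a b : R) : (a + b)%:C = a%:C + b%:C :> R[i].
Proof. exact: rmorphD. Qed.

Lemma realCM (a b : R) : (a * b)%:C = a%:C * b%:C :> R[i].
Proof. exact: rmorphM. Qed.

Lemma bounded_linear_submod_closed : submod_closed bounded_linear.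
Proof.
split=> [|a f g /asboolP[fl [M fM]] /asboolP[gl [N gN]]]; apply/asboolP.
  split=> [b x y|]; first by rewrite scaler0 addr0.
  by exists 0 => x; rewrite normr0 mul0r.
split=> [b x y|].
  rewrite /= !addrfctE !scalrfctE fl gl !scalerDr !scalerA [b * a]mulrC.
  by rewrite addrACA.
have aE : `|a| = (complex.Re `|a|)%:C by rewrite RRe_real ?normr_real.
exists (complex.Re `|a| * M + N) => x.
rewrite !addrfctE !scalrfctE (le_trans (ler_normD _ _)) //.
rewrite realCD realCM -aE mulrDl lerD //.
by rewrite normrZ -mulrA ler_wpM2l.
Qed.

HB.instance Definition _ :=
  GRing.isSubmodClosed.Build R[i] _ bounded_linear bounded_linear_submod_closed.
HB.instance Definition _ := [SubChoice_isSubLmodule of bop by <:].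

End BoundedOperators.


Section Adjoint.
Variables (R : realType).

Lemma Re_conj (z : R[i]) : complex.Re (Num.conj z) = complex.Re z.
Proof. by case: z. Qed.

Lemma Re_realM (a : R) (z : R[i]) : complex.Re (a%:C * z) = a * complex.Re z.
Proof. by case: z => u v /=; rewrite mul0r subr0. Qed.

Section RealInner.
Variable (H : hilbertType R).

Definition rinner (x y : H) : R := complex.Re '[x, y].

Lemma rinnerC x y : rinner x y = rinner y x.
Proof. by rewrite /rinner hermC mul1r Re_conj. Qed.

Lemma rinnerDl x y z : rinner (x + y) z = rinner x z + rinner y z.
Proof. by rewrite /rinner linearDl raddfD. Qed.

Lemma rinnerZl (a : R) x z : rinner (a%:C *: x) z = a * rinner x z.
Proof. by rewrite /rinner linearZl_LR Re_realM. Qed.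

Lemma rinnerDr x y z : rinner z (x + y) = rinner z x + rinner z y.
Proof. by rewrite !(rinnerC z) rinnerDl. Qed.

Lemma rinnerZr (a : R) x z : rinner z (a%:C *: x) = a * rinner z x.
Proof. by rewrite !(rinnerC z) rinnerZl. Qed.

Lemma rinnerNl x z : rinner (- x) z = - rinner x z.
Proof. by rewrite /rinner linearNl raddfN. Qed.

Lemma rinnerNr x z : rinner z (- x) = - rinner z x.
Proof. by rewrite !(rinnerC z) rinnerNl. Qed.

Lemma normr_rinner (x : H) : complex.Re `|x| ^+ 2 = rinner x x.
Proof. by rewrite /rinner -normr_inner [in RHS]normr_RRe !expr2 -realCM. Qed.

Lemma Re_normr_ge0 (x : H) : 0 <= complex.Re `|x|.
Proof. by rewrite -ler0c -normr_RRe. Qed.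

Lemma rinner_ge0 x : 0 <= rinner x x.
Proof. by rewrite -normr_rinner exprn_ge0 ?Re_normr_ge0. Qed.

Lemma ler_rinner x y : 2 * rinner x y <= rinner x x + rinner y y.
Proof.
have := rinner_ge0 (x - y).
by rewrite rinnerDl !rinnerDr !rinnerNl !rinnerNr (rinnerC y x); lra.
Qed.

End RealInner.

Lemma Re_normr_le (H K : hilbertType R) (u : H) (v : K) (M : R) :
  `|u| <= M%:C * `|v| -> complex.Re `|u| <= M * complex.Re `|v|.
Proof. by rewrite {1}(normr_RRe u) {1}(normr_RRe v) -realCM lecR. Qed.

Lemma bop_rbounded (H K : hilbertType R) (T : bop H K) :
  exists2 c : R, 0 < c & forall x y,
    2 * rinner (T x) y <= rinner x x + c * rinner y y.
Proof.
have [M TM] := bop_bounded T.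
pose c := `|M| + 1; have c0 : 0 < c by rewrite ltr_wpDl.
exists (c ^+ 2) => [|x y]; first by rewrite exprn_gt0.
have Tx : rinner (T x) (T x) <= c ^+ 2 * rinner x x.
  rewrite -!normr_rinner -exprMn lerXn2r ?nnegrE ?mulr_ge0 ?Re_normr_ge0 ?(ltW c0) //.
  have := Re_normr_le (TM x).
  move/le_trans; apply; rewrite ler_wpM2r ?Re_normr_ge0 //.
  by rewrite (le_trans (ler_norm _)) // lerDl.
have := ler_rinner ((c^-1)%:C *: T x) (c%:C *: y).
rewrite !(rinnerZl, rinnerZr) !mulrA -(mulrA 2) mulVf ?gt_eqF // mulr1.
move/le_trans; apply; rewrite -!expr2 lerD2r exprVn.
by rewrite ler_pdivrMl ?exprn_gt0.
Qed.

(* Riesz representation, real form: minimise |x|^2 - 2 g x. *)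
Lemma riesz_real (H : hilbertType R) (g : H -> R) (C : R) :
    (forall x y, g (x + y) = g x + g y) ->
    (forall (a : R) x, g (a%:C *: x) = a * g x) ->
    (forall x, 2 * g x <= rinner x x + C) ->
  exists y, forall x, g x = rinner x y.
Proof.
move=> gD gZ gC.
pose P x := rinner x x - 2 * g x.
pose A : set R := range P.
have infA : has_inf A.
  split; first by exists (P 0), 0.
  by exists (- C) => _ [x _ <-]; rewrite /P; have := gC x; lra.
pose d := inf A.
have dP x : d <= P x by apply: ge_inf; [case: infA|exists x].
have /choice[x_ x_P] n : exists x, P x < d + n.+1%:R^-1.
  have n0 : 0 < n.+1%:R^-1 :> R by rewrite invr_gt0 ltr0Sn.
  have [_ [x _ <-] Px] := inf_adherent n0 infA.
  by exists x.
have dist m n : rinner (x_ m - x_ n) (x_ m - x_ n) <=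
    2 * (m.+1%:R^-1 + n.+1%:R^-1).
  have := dP ((2^-1)%:C *: (x_ m + x_ n)); have := x_P m; have := x_P n.
  rewrite /P gZ gD !(rinnerZl, rinnerZr, rinnerDl, rinnerDr, rinnerNl, rinnerNr).
  rewrite (rinnerC (x_ n) (x_ m)).
  move: (m.+1%:R^-1) (n.+1%:R^-1) => i j.
  move: (rinner _ _) (rinner _ _) (rinner _ _) (g _) (g _) => a b c u v *. by lra.
have invlt (e : R) : 0 < e -> exists N, forall n, (N <= n)%N -> n.+1%:R^-1 < e.
  move=> e0; exists (Num.truncn e^-1) => n Nn.
  rewrite invf_plt ?posrE ?ltr0Sn //.
  by rewrite (lt_le_trans (truncnS_gt _)) // ler_nat.
have cauchyx : cauchy (x_ @ \oo).
  apply/cauchy_ballP => e e0.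
  have eR : e = (complex.Re e)%:C by rewrite RRe_real ?gtr0_real.
  have e'0 : 0 < complex.Re e by rewrite -ltcR -eR.
  have [N NP] := invlt (complex.Re e ^+ 2 / 4) ltac:(by rewrite divr_gt0 // exprn_gt0).
  exists (x_ @` [set n | (N <= n)%N], x_ @` [set n | (N <= n)%N]) => /=.
    by split; exists N => // n Nn /=; exists n.
  move=> [_ _] /= [[m Nm <-] [n Nn <-]]; rewrite -ball_normE /=.
  rewrite normr_RRe eR ltcR -(@ltr_pXn2r _ 2) ?nnegrE ?Re_normr_ge0 ?ltW //.
  rewrite normr_rinner (le_lt_trans (dist _ _)) //.
  have := NP _ Nm; have := NP _ Nn.
  move: (m.+1%:R^-1) (n.+1%:R^-1) (complex.Re e ^+ 2) => i j k ik jk; lra.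
have /cvg_ex[y xy] : cvg (x_ @ \oo) by exact: cauchy_cvg.
exists y => h.
have var k : 0 <= rinner k k + 2 * (rinner k y - g k).
  apply/ler_addgt0Pl => e e0.
  pose D := rinner k k + 2; have D0 : 0 < D by rewrite ltr_wpDl ?rinner_ge0.
  pose b := e / D; have b0 : 0 < b by rewrite divr_gt0.
  have [N NP] := invlt b b0.
  have b0C : 0 < b%:C :> R[i] by rewrite ltcR.
  move/cvgrPdist_lt : xy => /(_ _ b0C)[N' _ N'P].
  pose n := maxn N N'.
  have nb := NP n (leq_maxl _ _).
  have xyb : rinner (y - x_ n) (y - x_ n) < b ^+ 2.
    rewrite -normr_rinner ltr_pXn2r ?nnegrE ?Re_normr_ge0 ?(ltW b0) //.
    by rewrite -ltcR -normr_RRe; apply: (N'P n (leq_maxr _ _)).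
  have := dP (x_ n + k); have := x_P n.
  rewrite /P gD !rinnerDl !rinnerDr (rinnerC (x_ n) k) => Pn Pk.
  have := ler_rinner ((- b)%:C *: k) (y - x_ n).
  rewrite !(rinnerZl, rinnerZr) [rinner k (y - _)]rinnerDr rinnerNr => cs.
  have {}cs : b * (2 * (rinner k (x_ n) - rinner k y)) <=
      b * (b * rinner k k + b) by lra.
  rewrite ler_pM2l // in cs.
  have eE : e = b * rinner k k + b * 2 by rewrite -mulrDr /b mulfVK ?gt_eqF.
  move: (n.+1%:R^-1) Pn Pk cs nb => i Pn Pk cs nb; clearbody b d; lra.
pose z := rinner h y - g h; pose q := rinner h h.
pose s := (q + 1)^-1.
have q1 : 0 < q + 1 by rewrite ltr_wpDl ?rinner_ge0.
have s0 : 0 < s by rewrite invr_gt0.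
have sq : s * q = 1 - s by rewrite -[q](addrK 1) mulrBr mulVf ?gt_eqF // mulr1.
have := var ((- z * s)%:C *: h).
rewrite !(rinnerZl, rinnerZr) gZ -/q -mulrBr -/z.
have -> : - z * s * (- z * s * q) + 2 * (- z * s * z) =
    - (z ^+ 2 * (s * (1 + s))).
  by rewrite -!mulrA sq; ring.
rewrite oppr_ge0 pmulr_lle0 ?mulr_gt0 ?addr_gt0 // => z2.
have /eqP : z ^+ 2 = 0 by apply/le_anti; rewrite z2 sqr_ge0.
by rewrite sqrf_eq0 subr_eq0 => /eqP.
Qed.

(* The complex inner product is determined by its real part. *)
Lemma rinner_inj (H : hilbertType R) (y y' : H) :
  (forall x, rinner x y = rinner x y') -> y = y'.
Proof.
move=> yy'; apply/eqP; rewrite -subr_eq0 -normr_eq0 normr_RRe.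
have := normr_rinner (y - y'); rewrite rinnerDr rinnerNr yy' subrr => /eqP.
by rewrite sqrf_eq0 => /eqP ->.
Qed.

Lemma rinner_inner (H K : hilbertType R) (T : {linear H -> K}) (x : H)
    (y : K) (y' : H) :
  (forall x, rinner (T x) y = rinner x y') -> '[T x, y] = '[x, y'].
Proof.
move=> TyE; have := TyE ('i *: x); have := TyE x.
rewrite /rinner linearZ !linearZl_LR /=.
case: '[T x, y] '[x, y'] => [a b] [c d] /= -> /eqP.
by rewrite !mul0r !mul1r !sub0r eqr_opp => /eqP ->.
Qed.

Variables (H K : hilbertType R).

Lemma adjoint_exists (T : bop H K) :
  exists S : bop K H, forall x y, '[T x, y] = '[x, S y].
Proof.
have [c c0 Tc] := bop_rbounded T.
have /choice[S SP] y : exists y', forall x, rinner (T x) y = rinner x y'.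
  apply: (@riesz_real H (fun x => rinner (T x) y) (c * rinner y y)) => //.
  - by move=> u v; rewrite linearD rinnerDl.
  - by move=> a u; rewrite linearZ rinnerZl.
have SI x y := rinner_inner x (SP y).
have Sbl : S \in @bounded_linear R K H.
  apply/asboolP; split=> [a u v|].
    apply: rinner_inj => x.
    by rewrite /rinner -SI !linearDr !linearZr_LR /= !SI.
  exists (Num.sqrt c) => y.
  rewrite [leLHS]normr_RRe [X in _ * X]normr_RRe -realCM lecR.
  rewrite -(@ler_pXn2r _ 2) ?nnegrE ?mulr_ge0 ?sqrtr_ge0 ?Re_normr_ge0 //.
  rewrite exprMn sqr_sqrtr ?(ltW c0) // !normr_rinner.
  by have := Tc (S y) y; rewrite SP => ?; lra.
by exists (Bop Sbl).
Qed.

Definition adjoint (T : bop H K) : bop K H := sval (cid (adjoint_exists T)).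

Lemma adjointP (T : bop H K) x y : '[T x, y] = '[x, adjoint T y].
Proof. exact: (svalP (cid (adjoint_exists T))). Qed.

End Adjoint.

Section Composition.
Variables (R : realType) (H K L : hilbertType R).

Lemma bounded_linear_id : idfun \in @bounded_linear R H H.
Proof. by apply/asboolP; split=> //; exists 1 => x; rewrite mul1r. Qed.

Lemma bounded_linear_comp (S : bop K L) (T : bop H K) :
  S \o T \in @bounded_linear R H L.
Proof.
apply/asboolP; split=> [a x y|]; first by rewrite /= !linearP.
have [M SM] := bop_bounded S; have [N TN] := bop_bounded T.
exists (`|M| * N) => x; rewrite (le_trans (SM _)) //.
rewrite (@le_trans _ _ (`|M|%:C * `|T x|)) //.
  by rewrite ler_wpM2r // lecR ler_norm.
by rewrite realCM -mulrA ler_wpM2l // ler0c.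
Qed.

Definition bop_id : bop H H := Bop bounded_linear_id.
Definition bop_comp (S : bop K L) (T : bop H K) : bop H L :=
  Bop (bounded_linear_comp S T).

End Composition.

Arguments bop_id {R H}.
Notation "''L' ( H , K )" := (bop H K) (format "''L' ( H ,  K )") : type_scope.
Notation "''L' ( H )" := (bop H H) (format "''L' ( H )") : type_scope.
Notation "S '\oL' T" := (bop_comp S T)
  (at level 40, left associativity) : ring_scope.
Notation "T '^adj'" := (adjoint T) (at level 2, format "T '^adj'") : ring_scope.

(* Matrices with entries in L(H), acting on H^n = ('I_n -> H). *)
Section OperatorMatrices.
Variables (R : realType) (H : hilbertType R) (n : nat).

Definition opmx_apply (A : 'M['L(H)]_n) (x : 'I_n -> H) : 'I_n -> H :=
  fun i => \sum_j A i j (x j).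

Definition inner_pow (x y : 'I_n -> H) : R[i] := \sum_i '[x i, y i].

(* [0 <= z] in R[i] says that z is a nonnegative real number. *)
Definition opmx_positive (A : 'M['L(H)]_n) : Prop :=
  forall x, 0 <= inner_pow (opmx_apply A x) x.

Definition opmx_le (A B : 'M['L(H)]_n) : Prop := opmx_positive (B - A).

End OperatorMatrices.

Definition group_involution (G : groupType) (alpha : G -> G) : Prop :=
  [/\ involutive alpha, alpha 1%g = 1%g
    & forall g, alpha (g^-1)%g = ((alpha g)^-1)%g].

Record completely_positive (R : realType) (G : groupType) (alpha : G -> G)
    (H : hilbertType R) (phi : G -> 'L(H)) : Prop := CompletelyPositive {
  cp_alpha : forall g1 g2,
    phi (alpha g1 * alpha g2)%g = phi (alpha (g1 * g2)%g) /\
    phi (alpha (g1 * g2)%g) = phi (g1 * g2)%g ;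
  cp_positive : forall n (g : 'I_n -> G),
    opmx_positive (\matrix_(i, j) phi ((alpha (g i))^-1 * g j)%g) ;
  cp_bound : exists2 k : R, 0 < k & forall n (g : 'I_n -> G),
    opmx_le (\matrix_(i, j) ((phi (g i))^adj \oL phi (g j)))
      (\matrix_(i, j) (k%:C *: phi ((alpha (g i))^-1 * g j)%g)) ;
  cp_translate : forall h, exists2 m : R, 0 < m & forall n (g : 'I_n -> G),
    opmx_le (\matrix_(i, j) phi ((alpha (h * g i))^-1 * (h * g j))%g)
      (\matrix_(i, j) (m%:C *: phi ((alpha (g i))^-1 * g j)%g))
}.

(* (K, J) is a Krein space: J = J^* = J^-1. *)
Definition krein_space (R : realType) (K : hilbertType R) (J : 'L(K)) : Prop :=
  J^adj = J /\ J \oL J = bop_id.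

Record J_unitary_representation (R : realType) (G : groupType)
    (K : hilbertType R) (J : 'L(K)) (pi : G -> 'L(K)) : Prop :=
  JUnitaryRepresentation {
  urepM : forall g h, pi (g * h)%g = pi g \oL pi h ;
  urep1 : pi 1%g = bop_id ;
  urepV : forall g, pi (g^-1)%g = J \oL (pi g)^adj \oL J
}.

Definition lin_span (R : realType) (K : hilbertType R) (A : set K) : set K :=
  [set x | exists n (c : 'I_n -> R[i]) (a : 'I_n -> K),
    (forall i, A (a i)) /\ x = \sum_i c i *: a i].

Definition closed_span (R : realType) (K : hilbertType R) (A : set K) : set K :=
  closure (lin_span A).

(* Main.v *)
Require Import Defs.
From HB Require Import structures.
From mathcomp Require Import all_boot all_order all_algebra.
From mathcomp Require Import sesquilinear complex.
From mathcomp Require Import boolp classical_sets functions reals topology normedtype.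

                                                                         
                                                                              
                                                               
                      
                                                         
                                                     
                                                   
                                                                      
                                                                          
                                                                              
                                                                          
                                                                            
                                                                           
                                                                              
                      

Local Open Scope classical_set_scope.
Local Open Scope ring_scope.

Set Implicit Arguments.
Unset Strict Implicit.
Unset Printing Implicit Defensive.

Import Order.TTheory GRing.Theory Num.Theory.
Import numFieldNormedType.Exports.

Section InnerProduct.
Variable R : realType.

Lemma inner_ge0 (H : hilbertType R) (x : H) : 0 <= '[x, x].
Proof. by rewrite -normr_inner exprn_ge0. Qed.

Lemma inner_inj (H : hilbertType R) (x x' : H) :
  (forall y, '[x, y] = '[x', y]) -> x = x'.
Proof. by move=> xx'; apply: rinner_inj => y; rewrite /rinner 2!(innerC y) xx'. Qed.

Lemma adjointPl (H K : hilbertType R) (T : 'L(H, K)) x y :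
  '[T^adj y, x] = '[y, T x].
Proof. by rewrite innerC -adjointP -innerC. Qed.

Lemma inner_suml (H : hilbertType R) n (x : 'I_n -> H) y :
  '[\sum_i x i, y] = \sum_i '[x i, y].
Proof. exact: linear_sum (applyr inner y) _ _ _ _. Qed.

Lemma inner_sumr (H : hilbertType R) n x (y : 'I_n -> H) :
  '[x, \sum_i y i] = \sum_i '[x, y i].
Proof. exact: linear_sum. Qed.

Lemma bop_inner_bound (H K : hilbertType R) (T : 'L(H, K)) :
  exists2 m : R, 0 < m & forall x, '[T x, T x] <= m%:C%C * '[x, x].
Proof.
have [M TM] := bop_bounded T.
                                                                             
exists ((`|M| + 1) ^+ 2) => [|x]; first by rewrite exprn_gt0 ?ltr_wpDl.
rewrite -!normr_inner rmorphXn -exprMn lerXn2r ?nnegrE //.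
  by rewrite mulr_ge0 // ler0c addr_ge0.
rewrite (le_trans (TM x)) // ler_wpM2r // lecR.
by rewrite (le_trans (ler_norm _)) // lerDl.
Qed.

End InnerProduct.

Section GramMatrices.
Variable R : realType.

Lemma gram_form (H K : hilbertType R) n (T : 'I_n -> 'L(H, K)) x :
  inner_pow (opmx_apply (\matrix_(i, j) ((T i)^adj \oL T j)) x) x =
  '[\sum_j T j (x j), \sum_j T j (x j)].
Proof.
rewrite inner_sumr; apply: eq_bigr => i _.
rewrite /opmx_apply !inner_suml; apply: eq_bigr => j _.
by rewrite mxE /= adjointPl.
Qed.

Lemma gram_positive (H K : hilbertType R) n (T : 'I_n -> 'L(H, K)) :
  opmx_positive (\matrix_(i, j) ((T i)^adj \oL T j)).
Proof. by move=> x; rewrite gram_form inner_ge0. Qed.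

Lemma inner_pow_BZ (H : hilbertType R) n (c : R[i]) (A B : 'I_n -> 'I_n -> 'L(H)) x :
  inner_pow (opmx_apply (\matrix_(i, j) (c *: A i j) - \matrix_(i, j) B i j) x) x =
  c * inner_pow (opmx_apply (\matrix_(i, j) A i j) x) x -
  inner_pow (opmx_apply (\matrix_(i, j) B i j) x) x.
Proof.
rewrite /inner_pow mulr_sumr -sumrB; apply: eq_bigr => i _.
rewrite /opmx_apply !inner_suml mulr_sumr -sumrB; apply: eq_bigr => j _.
rewrite !mxE.
have -> : (c *: A i j - B i j) (x j) = c *: A i j (x j) - B i j (x j) by [].
by rewrite linearBl linearZl_LR.
Qed.

                                                                          
                                         
Lemma opmx_le_gram_comp (H K L : hilbertType R) (S : 'L(K, L)) :
  exists2 m : R, 0 < m & forall n (T : 'I_n -> 'L(H, K)),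
    opmx_le (\matrix_(i, j) ((S \oL T i)^adj \oL (S \oL T j)))
      (\matrix_(i, j) (m%:C%C *: ((T i)^adj \oL T j))).
Proof.
have [m m0 Sm] := bop_inner_bound S; exists m => // n T x.
rewrite inner_pow_BZ !gram_form subr_ge0.
have -> : \sum_j (S \oL T j) (x j) = S (\sum_j T j (x j)).
  by rewrite linear_sum.
exact: Sm.
Qed.

End GramMatrices.

Section Dilation.
Variables (R : realType) (G : groupType) (alpha : G -> G).
Variables (K : hilbertType R) (J : 'L(K)) (pi : G -> 'L(K)).
Variables (H : hilbertType R) (V : 'L(H, K)).
Hypothesis alpha_inv : group_involution alpha.
Hypothesis KJ : krein_space J.
Hypothesis piJ : J_unitary_representation J pi.
Hypothesis JpiV : forall g, J \oL pi g \oL V = pi (alpha g) \oL V.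

Let phi g := V^adj \oL pi g \oL V.

Lemma JK x : J (J x) = x.
Proof. by case: KJ => _ /(congr1 (fun T : 'L(K) => T x)). Qed.

Lemma inner_J x y : '[J x, y] = '[x, J y].
Proof. by case: KJ => JE _; rewrite adjointP JE. Qed.

Lemma pi_mul g h x : pi (g * h)%g x = pi g (pi h x).
Proof. by rewrite (urepM piJ). Qed.

Lemma J_pi_V g xi : J (pi g (V xi)) = pi (alpha g) (V xi).
Proof. exact: (congr1 (fun T : 'L(H, K) => T xi) (JpiV g)). Qed.

Lemma J_V xi : J (V xi) = V xi.
Proof.
have [_ alpha1 _] := alpha_inv.
by have := J_pi_V 1%g xi; rewrite alpha1 (urep1 piJ).
Qed.

                                                                           
                                               
Lemma J_unitaryP g x y : '[pi g x, y] = '[x, J (pi g^-1%g (J y))].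
Proof. by rewrite adjointP (urepV piJ) /= !JK. Qed.

Lemma inner_phi g x y : '[phi g x, y] = '[pi g (V x), V y].
Proof. exact: adjointPl. Qed.

Lemma dilation_gram g h :
  phi ((alpha g)^-1 * h)%g = (pi g \oL V)^adj \oL (pi h \oL V).
Proof.
apply: bopP => x; apply: inner_inj => y.
rewrite inner_phi pi_mul J_unitaryP invgK [RHS]adjointPl /=.
by rewrite J_V -J_pi_V JK.
Qed.

Lemma phi_alpha g : phi (alpha g) = phi g.
Proof.
apply: bopP => x; apply: inner_inj => y.
by rewrite !inner_phi -J_pi_V inner_J J_V.
Qed.

Lemma phi_mul_alpha g h : phi (alpha g * alpha h)%g = phi (g * h)%g.
Proof.
have [alphaK _ alphaV] := alpha_inv.
apply: bopP => x; apply: inner_inj => y.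
rewrite !inner_phi !pi_mul [LHS]J_unitaryP [RHS]J_unitaryP !J_V -alphaV.
by rewrite -[pi (alpha h) _]J_pi_V inner_J [in LHS]J_pi_V alphaK.
Qed.

End Dilation.

Theorem proposition2p7 (R : realType) (G : groupType) (alpha : G -> G)
    (K : hilbertType R) (J : 'L(K)) (pi : G -> 'L(K))
    (H : hilbertType R) (V : 'L(H, K)) :
  group_involution alpha ->
  krein_space J ->
  J_unitary_representation J pi ->
  closed_span [set pi g (V xi) | g in [set: G] & xi in [set: H]] = [set: K] ->
  (forall g, J \oL pi g \oL V = pi (alpha g) \oL V) ->
  completely_positive alpha (fun g => V^adj \oL pi g \oL V).
Proof.
move=> alpha_inv KJ piJ _ JpiV.
have gram := dilation_gram alpha_inv KJ piJ JpiV.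
have phiA := phi_alpha alpha_inv KJ piJ JpiV.
split=> [g1 g2|n g||h].
- by rewrite phiA (phi_mul_alpha alpha_inv KJ piJ JpiV).
- under eq_mx do rewrite gram.
  exact: gram_positive.
- have [k k0 kP] := opmx_le_gram_comp H V^adj; exists k => // n g.
  have assoc i : V^adj \oL pi (g i) \oL V = V^adj \oL (pi (g i) \oL V).
    exact: bopP.
  under eq_mx do rewrite !assoc.
  under eq_mx do rewrite gram.
  exact: kP.
- have [m m0 mP] := opmx_le_gram_comp H (pi h); exists m => // n g.
  have pi_comp i : pi (h * g i)%g \oL V = pi h \oL (pi (g i) \oL V).
    by apply: bopP => x /=; rewrite (urepM piJ).
  under eq_mx do rewrite gram !pi_comp.
  under eq_mx do rewrite gram.
  exact: mP.
Qed.
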